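(* Let $\mathfrak{g}=\mathfrak{gl}(m,n)$ be the general linear Lie superalgebra over $\mathbb{C}$, so $\mathfrak{g}_0=\mathfrak{gl}(m)\times\mathfrak{gl}(n)$. For a partition $\mu$ of $m$ and a partition $\nu$ of $n$, let $\mathcal{O}_{\mu,\nu}$ be the (adjoint) orbit of $(J_\mu,J_\nu)$ in $\mathfrak{g}_0$. Then $$k(\mathcal{O}_{\mu,\nu})=2\Big(mn-\sum_i \mu_i'\nu_i'\Big).$$
   Context: For a partition $\mu=(\mu_1\ge\mu_2\ge\cdots)$, $J_\mu$ is the nilpotent matrix with Jordan blocks of sizes $\mu_1,\mu_2,\ldots$, and $\mu'$ is the dual partition, $\mu_i'=|\{j:\mu_j\ge i\}|$ (parts beyond the last are $0$). Definition of $k$. For a finite dimensional Lie superalgebra $\mathfrak{g}=\mathfrak{g}_0\oplus\mathfrak{g}_1$ over $\mathbb{C}$ with basis $v_1,\dots,v_N$ of $\mathfrak{g}_1$, let $M(\mathfrak{g})=([v_i,v_j])_{i,j}$, a symmetric matrix with entries in $\mathfrak{g}_0\subset S(\mathfrak{g}_0)$. For a prime ideal $q$ of $S(\mathfrak{g}_0)$, $k(q)$ is the rank of $M(\mathfrak{g})$ modulo $q$, as a matrix over the fraction field of $S(\mathfrak{g}_0)/q$ (equivalently, the largest size of a minor of $M(\mathfrak{g})$ that is nonzero mod $q$). When $\mathfrak{g}_0$ is reductive, identify $\mathfrak{g}_0$ with $\mathfrak{g}_0^*$ using a nondegenerate invariant bilinear form (here, the form $(A,B)\mapsto \mathrm{trace}(AB)$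 on each of the two factors), so that elements of $S(\mathfrak{g}_0)$ are functions on $\mathfrak{g}_0$. For a nilpotent orbit $\mathcal{O}\subset\mathfrak{g}_0$, $k(\mathcal{O}):=k(q)$, where $q$ is the prime ideal of functions in $S(\mathfrak{g}_0)$ vanishing on $\mathcal{O}$. *)

(* Defs.v *)
From HB Require Import structures.
From mathcomp Require Import all_boot all_order all_algebra.
From mathcomp Require Import generic_quotient ring_quotient fraction.
From mathcomp Require Import mpoly complex.
From mathcomp Require Import boolp reals.
From mathcomp Require Import ring.

Set Implicit Arguments.
Unset Strict Implicit.
Unset Printing Implicit Defensive.

Import Order.TTheory GRing.Theory Num.Theory.
Local Open Scope ring_scope.
Local Open Scope quotient_scope.

Section ResidueField.
Variables (R : comNzRingType) (q : prime_idealr R).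

Definition quot_domain : Type := {ideal_quot q}.
HB.instance Definition _ := GRing.ComNzRing.on quot_domain.

(* An idomainType carries a unit predicate and an inverse function; both are
   obtained here by classical choice. *)
Definition quot_unit : pred quot_domain := fun x => `[< exists y, y * x = 1 >].

Definition quot_inv (x : quot_domain) : quot_domain :=
  if pselect (exists y, y * x = 1) is left ex then projT1 (cid ex) else x.

Lemma quot_mulVx : {in quot_unit, left_inverse 1 quot_inv *%R}.
Proof.
move=> x /asboolP ux; rewrite /quot_inv; case: pselect => // ex.
by case: (cid ex).
Qed.

Lemma quot_unitP x y : y * x = 1 -> quot_unit x.
Proof. by move=> yx; apply/asboolP; exists y. Qed.

Lemma quot_inv_out : {in [predC quot_unit], quot_inv =1 id}.
Proof.
move=> x /asboolP ux; rewrite /quot_inv; by case: pselect.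
Qed.

HB.instance Definition _ := GRing.ComNzRing_hasMulInverse.Build quot_domain
  quot_mulVx quot_unitP quot_inv_out.

Lemma quot_domain_integral : GRing.integral_domain_axiom quot_domain.
Proof. exact: Quotient.rquot_IdomainAxiom. Qed.

HB.instance Definition _ :=
  GRing.ComUnitRing_isIntegral.Build quot_domain quot_domain_integral.

Definition residue (x : R) : {fraction quot_domain} :=
  FracField.tofrac (\pi_{ideal_quot q} x : quot_domain).

Definition rank_mod (a b : nat) (M : 'M[R]_(a, b)) : nat :=
  \rank (map_mx residue M).

(* Sanity check: [residue] is a ring morphism with kernel exactly [q]. *)
Lemma residue_is_zmod_morphism : zmod_morphism residue.
Proof.
move=> x y; rewrite /residue -[RHS]raddfB; congr FracField.tofrac.
by rewrite -[RHS](raddfB (\pi_{ideal_quot q})).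
Qed.

Lemma residue_is_monoid_morphism : monoid_morphism residue.
Proof.
split=> [|x y]; first by rewrite /residue -[RHS]tofrac1 -[in RHS]pi_oner.
rewrite /residue -[RHS]tofracM; congr FracField.tofrac.
exact: (rmorphM (\pi_{ideal_quot q})).
Qed.

HB.instance Definition _ :=
  GRing.isZmodMorphism.Build R {fraction quot_domain} residue
    residue_is_zmod_morphism.
HB.instance Definition _ :=
  GRing.isMonoidMorphism.Build R {fraction quot_domain} residue
    residue_is_monoid_morphism.

Lemma residue_eq0 x : (residue x == 0) = (x \in (q : pred R)).
Proof.
rewrite /residue tofrac_eq0 -[x in RHS]subr0 Quotient.idealrBE.
by rewrite -[in LHS](raddf0 (\pi_{ideal_quot q})).
Qed.

End ResidueField.

Record lieSuperalgebra (K : fieldType) := LieSuperalgebra {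
  even_part : vectType K;
  odd_part : vectType K;
  br00 : even_part -> even_part -> even_part;
  br01 : even_part -> odd_part -> odd_part;
  br11 : odd_part -> odd_part -> even_part;
  br00_linear : forall x, linear (br00 x);
  br00_anti : forall x y, br00 x y = - br00 y x;
  br01_linearl : forall u, linear (br01^~ u);
  br01_linearr : forall x, linear (br01 x);
  br11_linear : forall u, linear (br11 u);
  br11_sym : forall u v, br11 u v = br11 v u;
  (* The four parity cases of the super Jacobi identity. *)
  jacobi000 : forall x y z,
    br00 x (br00 y z) = br00 (br00 x y) z + br00 y (br00 x z);
  jacobi001 : forall x y u,
    br01 x (br01 y u) = br01 (br00 x y) u + br01 y (br01 x u);
  jacobi011 : forall x u v,
    br00 x (br11 u v) = br11 (br01 x u) v + br11 u (br01 x v);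
  jacobi111 : forall u v w,
    br01 (br11 u v) w + br01 (br11 v w) u + br01 (br11 w u) v = 0
}.

Section SymmetricAlgebra.
Variables (K : fieldType) (V : vectType K).

(* S(V), as polynomials in the vectors of the basis [vbasis {:V}]. *)
Definition symalg := {mpoly K[\dim {:V}]}.
HB.instance Definition _ := GRing.ComNzRing.on symalg.

Definition sym_incl (x : V) : symalg :=
  \sum_(i < \dim {:V}) coord (vbasis {:V}) i x *: 'X_i.

Variable B : V -> V -> K.

(* p in S(V) as a function on V, a vector y being identified with the linear
   form B y _ on V. *)
Definition sym_fun (p : symalg) (x : V) : K :=
  p.@[fun i => B (vbasis {:V})`_i x].

Lemma sym_fun_incl y x : (forall z, scalar (B^~ z)) ->
  sym_fun (sym_incl y) x = B y x.
Proof.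
move=> linB; pose f : {scalar V} :=
  HB.pack (B^~ x) (GRing.isLinear.Build K V K *%R (B^~ x) (linB x)).
rewrite /sym_fun /sym_incl raddf_sum [in RHS](coord_vbasis (memvf y)).
rewrite -[RHS]/(f _) linear_sum; apply: eq_bigr => i _.
by rewrite [LHS]mevalZ mevalXU linearZ.
Qed.

Definition vanishing (O : V -> Prop) : pred symalg :=
  fun p => `[< forall x, O x -> sym_fun p x = 0 >].

End SymmetricAlgebra.

Section KNumber.
Variables (K : fieldType) (g : lieSuperalgebra K).

Definition bracket_mx (N : nat) (v : N.-tuple (odd_part g)) :
    'M[symalg (even_part g)]_N :=
  \matrix_(i, j) sym_incl (br11 (tnth v i) (tnth v j)).

(* To be used when [v] is a basis of the odd part. *)
Definition k_number (N : nat) (v : N.-tuple (odd_part g))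
    (q : prime_idealr (symalg (even_part g))) : nat :=
  rank_mod q (bracket_mx v).

End KNumber.

Section GeneralLinear.
Variables (K : fieldType) (m n : nat).
Local Notation g0 := ('M[K]_m * 'M[K]_n)%type.
Local Notation g1 := ('M[K]_(m, n) * 'M[K]_(n, m))%type.

Definition even_mx (x : g0) : 'M[K]_(m + n) := block_mx x.1 0 0 x.2.
Definition odd_mx (u : g1) : 'M[K]_(m + n) := block_mx 0 u.1 u.2 0.
Definition even_of (z : 'M[K]_(m + n)) : g0 := (ulsubmx z, drsubmx z).
Definition odd_of (z : 'M[K]_(m + n)) : g1 := (ursubmx z, dlsubmx z).

Definition gl_br00 x y :=
  even_of (even_mx x *m even_mx y - even_mx y *m even_mx x).
Definition gl_br01 x u :=
  odd_of (even_mx x *m odd_mx u - odd_mx u *m even_mx x).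
Definition gl_br11 u v :=
  even_of (odd_mx u *m odd_mx v + odd_mx v *m odd_mx u).

Lemma even_mxK : cancel even_mx even_of.
Proof. by case=> a b; rewrite /even_of block_mxKul block_mxKdr. Qed.
Lemma odd_mxK : cancel odd_mx odd_of.
Proof. by case=> a b; rewrite /odd_of block_mxKur block_mxKdl. Qed.

Lemma gl_br00E x y :
  even_mx (gl_br00 x y) = even_mx x *m even_mx y - even_mx y *m even_mx x.
Proof.
rewrite /gl_br00 /even_mx !mulmx_block !(mulmx0, mul0mx, addr0, add0r).
rewrite opp_block_mx add_block_mx !(oppr0, addr0).
by rewrite /even_of /= block_mxKul block_mxKdr.
Qed.

Lemma gl_br01E x u :
  odd_mx (gl_br01 x u) = even_mx x *m odd_mx u - odd_mx u *m even_mx x.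
Proof.
rewrite /gl_br01 /even_mx /odd_mx !mulmx_block.
rewrite !(mulmx0, mul0mx, addr0, add0r).
rewrite opp_block_mx add_block_mx !(oppr0, addr0).
by rewrite /odd_of /= block_mxKur block_mxKdl.
Qed.

Lemma gl_br11E u v :
  even_mx (gl_br11 u v) = odd_mx u *m odd_mx v + odd_mx v *m odd_mx u.
Proof.
rewrite /gl_br11 /even_mx /odd_mx !mulmx_block.
rewrite !(mulmx0, mul0mx, addr0, add0r).
rewrite add_block_mx !(oppr0, addr0).
by rewrite /even_of /= block_mxKul block_mxKdr.
Qed.

Lemma even_mxP a x y : even_mx (a *: x + y) = a *: even_mx x + even_mx y.
Proof.
by rewrite /even_mx scale_block_mx add_block_mx !(scaler0, addr0).
Qed.

Lemma odd_mxP a u v : odd_mx (a *: u + v) = a *: odd_mx u + odd_mx v.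
Proof.
by rewrite /odd_mx scale_block_mx add_block_mx !(scaler0, addr0).
Qed.

Lemma even_mxD x y : even_mx (x + y) = even_mx x + even_mx y.
Proof. by rewrite -[x]scale1r even_mxP !scale1r. Qed.

Lemma odd_mxD u v : odd_mx (u + v) = odd_mx u + odd_mx v.
Proof. by rewrite -[u]scale1r odd_mxP !scale1r. Qed.

Lemma even_mxN x : even_mx (- x) = - even_mx x.
Proof. by rewrite /even_mx opp_block_mx !oppr0. Qed.

Lemma odd_mx0 : odd_mx 0 = 0.
Proof. by rewrite /odd_mx /= -block_mx0. Qed.

Let even_inj := can_inj even_mxK.
Let odd_inj := can_inj odd_mxK.
Let brE := (gl_br00E, gl_br01E, gl_br11E).

Ltac expand_br :=
  rewrite ?(even_mxP, odd_mxP, even_mxD, odd_mxD, even_mxN, odd_mx0, brE);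
  rewrite ?(even_mxP, odd_mxP, even_mxD, odd_mxD, even_mxN, odd_mx0, brE);
  rewrite ?(mulmxDl, mulmxDr, mulmxBl, mulmxBr, mulNmx, mulmxN, mulmxA);
  rewrite -?(scalemxAl, scalemxAr).

Ltac by_entries :=
  repeat match goal with |- context [@mulmx ?R ?a ?b ?c ?A ?B] =>
    let z := fresh "z" in set z := @mulmx R a b c A B; clearbody z end;
  apply/matrixP => i j; rewrite !mxE; ring.

Lemma gl_br00_linear x : linear (gl_br00 x).
Proof. by move=> a y z; apply: even_inj; expand_br; by_entries. Qed.
Lemma gl_br00_anti x y : gl_br00 x y = - gl_br00 y x.
Proof. by apply: even_inj; expand_br; by_entries. Qed.
Lemma gl_br01_linearl u : linear (gl_br01^~ u).
Proof. by move=> a y z; apply: odd_inj; expand_br; by_entries. Qed.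
Lemma gl_br01_linearr x : linear (gl_br01 x).
Proof. by move=> a y z; apply: odd_inj; expand_br; by_entries. Qed.
Lemma gl_br11_linear u : linear (gl_br11 u).
Proof. by move=> a y z; apply: even_inj; expand_br; by_entries. Qed.
Lemma gl_br11_sym u v : gl_br11 u v = gl_br11 v u.
Proof. by apply: even_inj; expand_br; by_entries. Qed.
Lemma gl_jacobi000 x y z :
  gl_br00 x (gl_br00 y z) = gl_br00 (gl_br00 x y) z + gl_br00 y (gl_br00 x z).
Proof. by apply: even_inj; expand_br; by_entries. Qed.
Lemma gl_jacobi001 x y u :
  gl_br01 x (gl_br01 y u) = gl_br01 (gl_br00 x y) u + gl_br01 y (gl_br01 x u).
Proof. by apply: odd_inj; expand_br; by_entries. Qed.
Lemma gl_jacobi011 x u v :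
  gl_br00 x (gl_br11 u v) = gl_br11 (gl_br01 x u) v + gl_br11 u (gl_br01 x v).
Proof. by apply: even_inj; expand_br; by_entries. Qed.
Lemma gl_jacobi111 u v w :
  gl_br01 (gl_br11 u v) w + gl_br01 (gl_br11 v w) u + gl_br01 (gl_br11 w u) v
    = 0.
Proof. by apply: odd_inj; expand_br; by_entries. Qed.

Definition gl : lieSuperalgebra K :=
  @LieSuperalgebra K g0 g1 gl_br00 gl_br01 gl_br11
    gl_br00_linear gl_br00_anti gl_br01_linearl gl_br01_linearr
    gl_br11_linear gl_br11_sym
    gl_jacobi000 gl_jacobi001 gl_jacobi011 gl_jacobi111.

(* The trace form on each factor (not the supertrace form). *)
Definition gl_form (x y : g0) : K := \tr (x.1 *m y.1) + \tr (x.2 *m y.2).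

Definition gl_orbit (a x : g0) : Prop :=
  exists h : 'M[K]_m * 'M[K]_n,
    [/\ h.1 \in unitmx, h.2 \in unitmx &
        x = (h.1 *m a.1 *m invmx h.1, h.2 *m a.2 *m invmx h.2)].

Definition orbit_ideal (a : g0) : pred (symalg g0) :=
  vanishing gl_form (gl_orbit a).

End GeneralLinear.

Section OrbitPrime.
Variables (K : numFieldType) (m n : nat) (a : 'M[K]_m * 'M[K]_n).
Local Notation g0 := ('M[K]_m * 'M[K]_n)%type.
Local Notation S := (symalg g0).

(* On the line {(1 - t) h + t h'} in gl(m) x gl(n), a polynomial function of
   u a u^-1 is a polynomial in t divided by a power of det u. *)
Definition fractional (D : {poly K}) (f : K -> K) : Prop :=
  exists (N : nat) (P : {poly K}),
    forall t, D.[t] != 0 -> D.[t] ^+ N * f t = P.[t].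

Lemma fractionalC D c : fractional D (fun=> c).
Proof. by exists 0, c%:P => t _; rewrite mul1r hornerC. Qed.

Lemma fractionalD D f1 f2 : fractional D f1 -> fractional D f2 ->
  fractional D (fun t => f1 t + f2 t).
Proof.
move=> [N1 [P1 h1]] [N2 [P2 h2]].
exists (N1 + N2)%N, (D ^+ N2 * P1 + D ^+ N1 * P2) => t Dt.
by rewrite hornerD !hornerM !horner_exp -h1 // -h2 // exprD; ring.
Qed.

Lemma fractionalM D f1 f2 : fractional D f1 -> fractional D f2 ->
  fractional D (fun t => f1 t * f2 t).
Proof.
move=> [N1 [P1 h1]] [N2 [P2 h2]]; exists (N1 + N2)%N, (P1 * P2) => t Dt.
by rewrite hornerM -h1 // -h2 // exprD; ring.
Qed.

Lemma fractionalX D f k : fractional D f -> fractional D (fun t => f t ^+ k).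
Proof.
move=> hf; elim: k => [|k IH]; first exact: fractionalC.
have [N [P h]] := fractionalM hf IH.
by exists N, P => t Dt; rewrite exprS h.
Qed.

Lemma fractional_sum (I : Type) (r : seq I) D (f : I -> K -> K) :
  (forall i, fractional D (f i)) ->
  fractional D (fun t => \sum_(i <- r) f i t).
Proof.
move=> hf; elim: r => [|i r IH].
  by exists 0, 0 => t _; rewrite big_nil mulr0 horner0.
have [N [P h]] := fractionalD (hf i) IH.
by exists N, P => t Dt; rewrite big_cons h.
Qed.

Lemma fractional_prod (I : Type) (r : seq I) D (f : I -> K -> K) :
  (forall i, fractional D (f i)) ->
  fractional D (fun t => \prod_(i <- r) f i t).
Proof.
move=> hf; elim: r => [|i r IH].
  by exists 0, 1 => t _; rewrite big_nil mulr1 hornerC.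
have [N [P h]] := fractionalM (hf i) IH.
by exists N, P => t Dt; rewrite big_cons h.
Qed.

Lemma fractional_meval D k (w : 'I_k -> K -> K) (p : {mpoly K[k]}) :
  (forall i, fractional D (w i)) -> fractional D (fun t => p.@[w^~ t]).
Proof.
move=> hw.
have [|N [P h]] := @fractional_sum _ (msupp p) D
    (fun c t => p@_c * \prod_(i < k) w i t ^+ c i).
  move=> c; apply: fractionalM; first exact: fractionalC.
  by apply: fractional_prod => i; apply: fractionalX.
by exists N, P => t Dt; rewrite mevalE h.
Qed.

Definition line_mx k (g h : 'M[K]_k) : 'M[{poly K}]_k :=
  (1 - 'X) *: map_mx polyC g + 'X *: map_mx polyC h.

Lemma line_mxE k (g h : 'M[K]_k) t :
  map_mx (horner_eval t) (line_mx g h) = (1 - t) *: g + t *: h.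
Proof. by apply/matrixP=> i j; rewrite !mxE /horner_eval !hornerE. Qed.

Lemma line_mx_det k (g h : 'M[K]_k) t :
  (\det (line_mx g h)).[t] = \det ((1 - t) *: g + t *: h).
Proof. by rewrite -line_mxE det_map_mx. Qed.

Lemma fractional_conj k (b c g h : 'M[K]_k) (E : {poly K}) :
  fractional (\det (line_mx g h) * E)
    (fun t => let u := (1 - t) *: g + t *: h in
       \tr (b *m (u *m c *m invmx u))).
Proof.
pose T : {poly K} := \tr (map_mx polyC b *m
  (line_mx g h *m map_mx polyC c *m \adj (line_mx g h))).
exists 1, (E * T) => t.
rewrite hornerM mulf_eq0 negb_or => /andP[Dt _] /=; set u := _ + _.
have du : \det u = (\det (line_mx g h)).[t] by rewrite line_mx_det.
have uu : u \in unitmx by rewrite unitmxE unitfE du.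
have idC k' (x : 'M[K]_k') : map_mx (horner_eval t) (map_mx polyC x) = x.
  by apply/matrixP=> i j; rewrite !mxE /horner_eval hornerC.
have TE : T.[t] = \tr (b *m (u *m c *m \adj u)).
  rewrite -[LHS]/(horner_eval t T) /T -trace_map_mx.
  rewrite [map_mx _ _]map_mxM [X in _ *m X]map_mxM.
  by rewrite [X in _ *m (X *m _)]map_mxM map_mx_adj line_mxE !idC.
rewrite expr1 (hornerM E T t) TE /invmx uu -!scalemxAr mxtraceZ du.
by field.
Qed.

Lemma poly_all0 (P : {poly K}) : (forall t, P.[t] = 0) -> P = 0.
Proof.
move=> P0; apply/eqP/negPn/negP => nz.
have := @max_poly_roots _ P [seq i%:R | i <- iota 0 (size P)] nz.
rewrite size_map size_iota ltnn => h; apply/notF/h.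
  by apply/allP => x _; rewrite /root P0.
rewrite map_inj_in_uniq ?iota_uniq // => i j _ _ /eqP.
by rewrite eqr_nat => /eqP.
Qed.

Lemma orbit_ideal_idealr : idealr_closed (orbit_ideal a).
Proof.
split.
- by apply/asboolP => x _; rewrite /sym_fun meval0.
- apply/asboolPn => /(_ a).
  have aa : gl_orbit a a.
    exists (1%:M, 1%:M); rewrite /= !unitmx1 !invmx1 !mul1mx !mulmx1.
    by split=> //; case: a.
  by move=> /(_ aa)/eqP; rewrite /sym_fun meval1 oner_eq0.
- move=> c p r /asboolP hp /asboolP hr; apply/asboolP => x Ox.
  have := hp x Ox; have := hr x Ox; rewrite /sym_fun => r0 p0.
  by rewrite mevalD mevalM r0 p0 mulr0 addr0.
Qed.

Lemma orbit_ideal_prime : prime_idealr_closed (orbit_ideal a).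
Proof.
move=> p q /asboolP pq0; apply/negPn/negP; rewrite negb_or => /andP[].
move=> /asboolPn/existsNP[x /not_implyP[Ox px]].
move=> /asboolPn/existsNP[y /not_implyP[Oy qy]].
case: Ox px => -[g1 g2] /= [ug1 ug2 ->] px.
case: Oy qy => -[h1 h2] /= [uh1 uh2 ->] qy.
pose D := \det (line_mx g1 h1) * \det (line_mx g2 h2).
pose u1 t := (1 - t) *: g1 + t *: h1; pose u2 t := (1 - t) *: g2 + t *: h2.
pose z t : g0 := (u1 t *m a.1 *m invmx (u1 t), u2 t *m a.2 *m invmx (u2 t)).
have fracS (r : S) : fractional D (fun t => sym_fun (@gl_form K m n) r (z t)).
  apply: fractional_meval => i; apply: fractionalD.
    exact: fractional_conj.
  by rewrite /D mulrC; apply: fractional_conj.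
have zO t : D.[t] != 0 -> gl_orbit a (z t).
  rewrite hornerM mulf_eq0 negb_or !line_mx_det => /andP[d1 d2].
  by exists (u1 t, u2 t); split; rewrite ?unitmxE ?unitfE.
have [N [P hP]] := fracS p; have [M [Q hQ]] := fracS q.
have PQD : P * Q * D = 0.
  apply: poly_all0 => t; rewrite (hornerM (P * Q) D t) (hornerM P Q t).
  have [-> | Dt] := eqVneq D.[t] 0; first by rewrite mulr0.
  have := pq0 _ (zO t Dt); rewrite /sym_fun mevalM => e.
  rewrite -hP // -hQ //= [_ * _ * (_ * _)]mulrACA.
  by rewrite /sym_fun e mulr0 mul0r.
have D0 : D.[0] != 0.
  rewrite hornerM mulf_neq0 // line_mx_det subr0 scale1r scale0r addr0;
  by rewrite -unitfE -unitmxE.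
have D1 : D.[1] != 0.
  rewrite hornerM mulf_neq0 // line_mx_det subrr scale0r scale1r add0r;
  by rewrite -unitfE -unitmxE.
have P0 : P.[0] != 0.
  rewrite -hP // mulf_neq0 ?expf_neq0 //; apply/eqP.
  by rewrite /z /u1 /u2 !subr0 !scale1r !scale0r !addr0.
have Q1 : Q.[1] != 0.
  rewrite -hQ // mulf_neq0 ?expf_neq0 //; apply/eqP.
  by rewrite /z /u1 /u2 !subrr !scale1r !scale0r !add0r.
move/eqP: PQD; rewrite mulf_eq0 mulf_eq0 -orbA => /or3P[] /eqP e.
- by rewrite e horner0 eqxx in P0.
- by rewrite e horner0 eqxx in Q1.
- by rewrite e horner0 eqxx in D0.
Qed.

HB.instance Definition _ := isIdealr.Build S (orbit_ideal a) orbit_ideal_idealr.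
HB.instance Definition _ :=
  isPrimeIdealrClosed.Build S (orbit_ideal a) orbit_ideal_prime.

Definition orbit_prime : prime_idealr S := orbit_ideal a.

End OrbitPrime.

Record intpart (n : nat) := IntPart {
  parts :> seq nat;
  parts_sorted : sorted geq parts;
  parts_pos : 0%N \notin parts;
  parts_sumn : sumn parts = n
}.

Lemma parts_sum n (mu : intpart n) : (\sum_(i < size mu) nth 0 mu i = n)%N.
Proof.
by rewrite -[RHS](parts_sumn mu) sumnE (big_nth 0%N) big_mkord.
Qed.

Definition dual_part n (mu : intpart n) (i : nat) : nat :=
  count (fun x => i <= x)%N mu.

Definition jordan_block (K : fieldType) (k : nat) : 'M[K]_k :=
  \matrix_(i, j) (j == i.+1 :> nat)%:R.

Definition jordan_nilp (K : fieldType) n (mu : intpart n) : 'M[K]_n :=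
  castmx (parts_sum mu, parts_sum mu)
    (\mxdiag_(i < size mu) jordan_block K (nth 0%N mu i)).

(* Main.v *)
(* The rank of M(g) modulo the ideal of the orbit is the largest size of a minor
   that is nonzero somewhere on the orbit, hence the common rank of M(g)
   evaluated at the points x = (x1, x2) of the orbit. There M(g) is the Gram
   matrix of the form (u, v) |-> (x, [u, v]) on the odd part, whose radical
   consists of the u = (A, B) with x1 A + A x2 = 0 and x2 B + B x1 = 0. Up to
   conjugation x1 and x2 are direct sums of Jordan blocks, and for blocks of
   sizes k and l the solutions of J_k A + A J_l = 0 form a space of dimension
   min(k, l). Both kernels thus have dimension sum_(i, j) min(mu_i, nu_j)
   = sum_k mu'_k nu'_k. *)
From HB Require Import structures.
Require Import Defs.
From mathcomp Require Import all_boot all_order all_algebra.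
From mathcomp Require Import mpoly complex reals.
From mathcomp Require Import boolp ring zify.

Set Implicit Arguments.
Unset Strict Implicit.
Unset Printing Implicit Defensive.

Import GRing.Theory Num.Theory.
Local Open Scope ring_scope.

(* [P] is a linear subspace of dimension [d]: [e] parametrizes it and [f] is a
   (not necessarily linear) retraction. *)
Definition has_dim (K : fieldType) (V : lmodType K) (d : nat) (P : V -> Prop) :=
  exists (e : 'rV[K]_d -> V) (f : V -> 'rV[K]_d),
    [/\ linear e, cancel e f & forall v, P v <-> e (f v) = v].

(** * Dimensions of subspaces through explicit parametrizations *)

Section Dimension.
Variable K : fieldType.

Lemma has_dim_iso (V W : lmodType K) (d : nat) (P : V -> Prop) (Q : W -> Prop)
    (f : V -> W) (g : W -> V) :
    linear f -> cancel f g -> cancel g f -> (forall v, P v <-> Q (f v)) ->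
  has_dim d P -> has_dim d Q.
Proof.
move=> linf fK gK PQ [e [h [line eK Ph]]].
exists (f \o e), (h \o g); split=> [a x y|x|w] /=; first by rewrite line linf.
  by rewrite fK eK.
rewrite -{1}[w]gK -PQ Ph; split=> [->|/(congr1 g)]; first exact: gK.
by rewrite fK.
Qed.

Lemma has_dim_pair (V W : lmodType K) (d1 d2 : nat) (P : V -> Prop)
    (Q : W -> Prop) :
  has_dim d1 P -> has_dim d2 Q ->
  has_dim (d1 + d2) (fun u : V * W => P u.1 /\ Q u.2).
Proof.
move=> [e1 [f1 [lin1 e1K Pf]]] [e2 [f2 [lin2 e2K Qf]]].
exists (fun c => (e1 (lsubmx c), e2 (rsubmx c))).
exists (fun u => row_mx (f1 u.1) (f2 u.2)); split=> [a x y|c|[v w]] /=.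
- by rewrite !linearP lin1 lin2.
- by rewrite e1K e2K hsubmxK.
- by rewrite row_mxKl row_mxKr Pf Qf; split=> [[-> ->]|[-> ->]].
Qed.

(** Rank-nullity: the matrix of the parametrization has [d] independent rows, and these span the
    left kernel of [M]. *)
Lemma rank_has_dim_ker (N d : nat) (M : 'M[K]_N) :
  has_dim d (fun w : 'rV[K]_N => w *m M = 0) -> (\rank M + d)%N = N.
Proof.
move=> [e [f [line eK Pf]]].
pose e' : {linear 'rV[K]_d -> 'rV[K]_N} :=
  HB.pack e (GRing.isLinear.Build K _ _ _ e line).
have eE c : c *m lin1_mx e' = e c by rewrite mul_rV_lin1.
have e0 : e 0 = 0 by rewrite -eE mul0mx.
have free_e : row_free (lin1_mx e').
  by apply: inj_row_free => c; rewrite eE -e0 => /(can_inj eK).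
have ker_e : (kermx M :=: lin1_mx e')%MS.
  apply/eqmxP/andP; split; apply/row_subP => i; last first.
    apply/sub_kermxP; apply/Pf; rewrite rowE eE eK; congr e.
  have /sub_kermxP/Pf <- := row_sub i (kermx M).
  by rewrite -eE submxMl.
have := mxrank_ker M; rewrite ker_e (eqP free_e) => ->.
by rewrite subnKC // rank_leq_row.
Qed.

(** Conditions imposed on separate blocks are independent, so a parameter vector is the
    concatenation of one parameter vector per block. *)
Lemma has_dim_mxblock (p q : nat) (p_ : 'I_p -> nat) (q_ : 'I_q -> nat)
    (d : 'I_p -> 'I_q -> nat) (P : forall i j, 'M[K]_(p_ i, q_ j) -> Prop) :
    (forall i j, has_dim (d i j) (@P i j)) ->
  has_dim (\sum_i \sum_j d i j)
    (fun A : 'M[K]_(\sum_i p_ i, \sum_j q_ j) =>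
       forall i j, P i j (submxblock A i j)).
Proof.
move=> dimP; pose e i j := projT1 (cid (dimP i j)).
pose f i j := projT1 (cid (projT2 (cid (dimP i j)))).
have ef i j : [/\ linear (e i j), cancel (e i j) (f i j) &
    forall A, P i j A <-> e i j (f i j A) = A].
  exact: projT2 (cid (projT2 (cid (dimP i j)))).
exists (fun c => \mxblock_(i, j) e i j (submxrow (submxrow c i) j)).
exists (fun A => \mxrow_i \mxrow_j f i j (submxblock A i j)).
split=> [a x y|c|A].
- apply/mxblockP => i j; have [line _ _] := ef i j.
  have submxrowP r s (s_ : 'I_s -> nat) (B C : 'M[K]_(r, \sum_k s_ k)) k :
    submxrow (a *: B + C) k = a *: submxrow B k + submxrow C k.
    by apply/matrixP => ? ?; rewrite !mxE.
  have submxblockP (B C : 'M[K]_(\sum_k p_ k, \sum_k q_ k)) :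
    submxblock (a *: B + C) i j = a *: submxblock B i j + submxblock C i j.
    by apply/matrixP => ? ?; rewrite !mxE.
  by rewrite submxblockP !mxblockK !submxrowP line.
- apply/mxrowP => i; rewrite mxrowK; apply/mxrowP => j.
  by rewrite mxrowK mxblockK; have [_ -> _] := ef i j.
- split=> [PA|<- i j].
    apply/mxblockP => i j; rewrite mxblockK !mxrowK.
    by have [_ _ <-] := ef i j.
  rewrite mxblockK !mxrowK; have [_ eK ->] := ef i j; by rewrite eK.
Qed.

End Dimension.

(** * Rank and minors *)

(** Minors commute with ring morphisms, which lets ranks over different fields be compared.
    Injectivity of [f] and [g] need not be required: a repeated index makes the determinant zero. *)
Lemma mxrank_minor (F : fieldType) (a b r : nat) (A : 'M[F]_(a, b)) :
  (r <= \rank A)%N <->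
  exists (f : 'I_r -> 'I_a) (g : 'I_r -> 'I_b), \det (mxsub f g A) != 0.
Proof.
split=> [le_r|[f [g detA]]]; last first.
  have /mxrank_unit <- : mxsub f g A \in unitmx by rewrite unitmxE unitfE.
  rewrite mxsubrc; apply: leq_trans (mxrankS (rowsub_sub _ _)) _.
  rewrite -mxrank_tr trmx_mxsub -[\rank A]mxrank_tr.
  exact/mxrankS/rowsub_sub.
pose B := rowsub (maxrankfun A \o widen_ord le_r) A.
have freeB : row_free B.
  have -> : B = rowsub (widen_ord le_r) (rowsub (maxrankfun A) A).
    exact: rowsub_comp.
  rewrite rowsubE; apply/row_freeP.
  have /row_freeP[C AC] := maxrowsub_free A.
  (* With [W] the matrix selecting the first [r] rows, [C] followed by the transpose of [W] is a
     right inverse of the selected rows. *)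
  exists (C *m (rowsub (widen_ord le_r) 1%:M)^T).
  rewrite mulmxA -(mulmxA _ _ C) AC mulmx1; apply/matrixP => i j.
  rewrite !mxE (bigD1 (widen_ord le_r i)) //= !mxE eqxx mul1r big1 ?addr0.
    by rewrite eq_sym -(inj_eq val_inj).
  by move=> k ki; rewrite !mxE eq_sym (negPf ki) mul0r.
have fullB : row_full B^T by rewrite /row_full mxrank_tr.
exists (maxrankfun A \o widen_ord le_r), (fullrankfun fullB).
rewrite -unitfE -unitmxE -unitmx_tr.
have -> : (mxsub (maxrankfun A \o widen_ord le_r) (fullrankfun fullB) A)^T
    = rowsub (fullrankfun fullB) B^T by apply/matrixP => i j; rewrite !mxE.
exact: fullrowsub_unit.
Qed.

(** * The equation [J A + A J = 0] for a pair of Jordan blocks *)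

Section JordanBlocks.
Variable K : fieldType.

(* Counting columns from the right turns [J A + A J = 0] into
   [E (a + 1) c = - E a (c + 1)], so that a solution depends, up to sign, only
   on [a + c]. *)
Definition col_rev_ext (k l : nat) (A : 'M[K]_(k, l)) (a c : nat) : K :=
  if insub a is Some i then if insub c is Some j then A i (rev_ord j) else 0
  else 0.

Variables k l : nat.
Implicit Type A : 'M[K]_(k, l).

Lemma col_rev_extE A (i : 'I_k) (j : 'I_l) :
  col_rev_ext A i j = A i (rev_ord j).
Proof. by rewrite /col_rev_ext !valK. Qed.

Lemma col_rev_ext_row A a c : (k <= a)%N -> col_rev_ext A a c = 0.
Proof. by move=> ka; rewrite /col_rev_ext insubN // -leqNgt. Qed.

Lemma col_rev_ext_col A a c : (l <= c)%N -> col_rev_ext A a c = 0.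
Proof.
move=> lc; rewrite /col_rev_ext [insub c]insubN ?if_same; last by rewrite -leqNgt.
by case: insub.
Qed.

(** Left multiplication by [J] shifts rows up; the zero extension accounts for the last row becoming
    zero. *)
Lemma mul_jordan_block_mx A (i : 'I_k) (j : 'I_l) :
  (jordan_block K k *m A) i (rev_ord j) = col_rev_ext A i.+1 j.
Proof.
rewrite mxE; case: (ltnP i.+1 k) => [lt_ik|le_ki]; last first.
  rewrite col_rev_ext_row // big1 // => r _; rewrite mxE.
  by case: eqP => [ri|_]; [rewrite -ri leqNgt ltn_ord in le_ki | rewrite mul0r].
rewrite (bigD1 (Ordinal lt_ik)) //= mxE eqxx mul1r big1 ?addr0.
  by rewrite -(col_rev_extE A (Ordinal lt_ik)).
by move=> r; rewrite -(inj_eq val_inj) mxE /= => /negPf->; rewrite mul0r.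
Qed.

(** Right multiplication shifts columns to the right, that is, from [j] to [j.+1] when counted from
    the right; the first column becomes zero. *)
Lemma mul_mx_jordan_block A (i : 'I_k) (j : 'I_l) :
  (A *m jordan_block K l) i (rev_ord j) = col_rev_ext A i j.+1.
Proof.
rewrite mxE; case: (ltnP j.+1 l) => [lt_jl|le_lj]; last first.
  rewrite col_rev_ext_col // big1 // => r _; rewrite mxE /=.
  by case: eqP => [|_]; [lia | rewrite mulr0].
rewrite (bigD1 (rev_ord (Ordinal lt_jl))) //= mxE /= big1 ?addr0.
  rewrite (_ : (_ == _) = true) ?mulr1 -?(col_rev_extE A i (Ordinal lt_jl)) //.
  by apply/eqP => /=; lia.
move=> r; rewrite -(inj_eq val_inj) mxE /= => ne.
by case: eqP => [ri|_]; [case/eqP: ne; lia | rewrite mulr0].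
Qed.

Lemma jordan_block_sylvester A :
  jordan_block K k *m A + A *m jordan_block K l = 0 <->
  forall a c, (a < k)%N -> (c < l)%N ->
    col_rev_ext A a.+1 c = - col_rev_ext A a c.+1.
Proof.
split=> [eqA a c lt_a lt_c|extA].
  have /matrixP/(_ (Ordinal lt_a) (rev_ord (Ordinal lt_c))) := eqA.
  rewrite mxE mul_jordan_block_mx mul_mx_jordan_block [RHS]mxE => /eqP.
  by rewrite addr_eq0 => /eqP.
apply/matrixP => i j; rewrite -[j]rev_ordK.
by rewrite mxE mul_jordan_block_mx mul_mx_jordan_block extA // addNr mxE.
Qed.

(** Each step towards row 0 along a line of constant [a + c] costs a sign. The range includes
    [a = k], one row past the matrix, where the left side is zero. *)
Lemma jordan_block_sylvester_row0 A :
    jordan_block K k *m A + A *m jordan_block K l = 0 ->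
  forall a c, (a <= k)%N -> col_rev_ext A a c = (-1) ^+ a * col_rev_ext A 0 (a + c).
Proof.
move=> /jordan_block_sylvester extA; elim=> [|a IH] c lt_a.
  by rewrite mul1r.
case: (ltnP c l) => [lt_c|le_c].
  by rewrite extA // IH 1?ltnW // addSnnS exprS mulN1r mulNr.
by rewrite !col_rev_ext_col ?mulr0 //; lia.
Qed.

(** For [l <= c] the column is outside the matrix. For [k <= c] the line of constant index sum
    reaches the zero row [k], at column [c - k]. *)
Lemma jordan_block_sylvester_eq0 A :
    jordan_block K k *m A + A *m jordan_block K l = 0 ->
  forall c, (minn k l <= c)%N -> col_rev_ext A 0 c = 0.
Proof.
move=> kerA c; rewrite geq_min; case: (ltnP c l) => [_|le_c _]; last first.
  exact: col_rev_ext_col.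
rewrite orbF => le_kc; have := jordan_block_sylvester_row0 kerA (c - k) (leqnn k).
rewrite subnKC // col_rev_ext_row // => /eqP.
by rewrite eq_sym mulf_eq0 signr_eq0 => /eqP.
Qed.

End JordanBlocks.

(** * Dimension of the solution space, from single blocks to conjugates of direct sums *)

Section SylvesterKernel.
Variable K : fieldType.

(** The default 0 makes the entries of index sum at least [d] vanish in the parametrization of
    solutions. *)
Definition row_ext d (c : 'rV[K]_d) (x : nat) : K :=
  if insub x is Some y then c 0 y else 0.

Lemma row_extP d (a : K) (b c : 'rV[K]_d) x :
  row_ext (a *: b + c) x = a * row_ext b x + row_ext c x.
Proof. by rewrite /row_ext; case: insub => [y|]; rewrite ?mxE ?mulr0 ?addr0. Qed.

(** A solution is determined by its row 0, whose last [minn k l] entries are free and whose other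
    entries are zero. *)
Lemma has_dim_jordan_block (k l : nat) :
  has_dim (minn k l) (fun A : 'M[K]_(k, l) =>
    jordan_block K k *m A + A *m jordan_block K l = 0).
Proof.
pose e (c : 'rV[K]_(minn k l)) : 'M[K]_(k, l) :=
  \matrix_(i, j) ((-1) ^+ i * row_ext c (i + rev_ord j)%N).
pose f (A : 'M[K]_(k, l)) : 'rV[K]_(minn k l) := \row_c col_rev_ext A 0 c.
(* This also holds just outside the matrix: if [a = k] or [l <= b], then [a + b] is at least
   [minn k l] and both sides vanish. *)
have eE c a b : (a <= k)%N ->
    col_rev_ext (e c) a b = (-1) ^+ a * row_ext c (a + b)%N.
  move=> le_a; have [lt_b|le_b] := ltnP b l; last first.
    by rewrite col_rev_ext_col // /row_ext insubN ?mulr0 //; lia.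
  have [lt_a|le_ka] := ltnP a k; last first.
    by rewrite col_rev_ext_row // /row_ext insubN ?mulr0 //; lia.
  rewrite (col_rev_extE (e c) (Ordinal lt_a) (Ordinal lt_b)) mxE rev_ordK.
  by [].
have e_ker c : jordan_block K k *m e c + e c *m jordan_block K l = 0.
  apply/jordan_block_sylvester => a b lt_a lt_b.
  by rewrite !eE ?(ltnW lt_a) // addSnnS exprS mulN1r mulNr.
exists e, f; split=> [a x y|c|A].
- by apply/matrixP => i j; rewrite !mxE row_extP; ring.
- apply/rowP => x; rewrite mxE eE // mul1r /row_ext /= add0n.
  by rewrite valK.
- split=> [kerA|<-]; last exact: e_ker.
  apply/matrixP => i j; rewrite -[j]rev_ordK -!col_rev_extE eE 1?ltnW //.
  rewrite (jordan_block_sylvester_row0 kerA) 1?ltnW //; congr (_ * _).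
  rewrite /row_ext; case: insubP => [x _ <-|]; first by rewrite mxE.
  by rewrite -leqNgt => /(jordan_block_sylvester_eq0 kerA).
Qed.

(** The substitution of [h1 *m A *m invmx h2] for [A] carries one equation into the other. *)
Lemma has_dim_conj (m n d : nat) (a1 h1 : 'M[K]_m) (a2 h2 : 'M[K]_n) :
    h1 \in unitmx -> h2 \in unitmx ->
    has_dim d (fun A : 'M[K]_(m, n) => a1 *m A + A *m a2 = 0) ->
  has_dim d (fun A : 'M[K]_(m, n) =>
    (h1 *m a1 *m invmx h1) *m A + A *m (h2 *m a2 *m invmx h2) = 0).
Proof.
move=> u1 u2; apply: (@has_dim_iso _ _ _ _ _ _
  (fun A => h1 *m A *m invmx h2) (fun A => invmx h1 *m A *m h2)) => [a A B|A|A|A].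
- by rewrite mulmxDr mulmxDl -scalemxAr -scalemxAl.
- by rewrite !mulmxA mulVmx // mul1mx mulmxKV.
- by rewrite !mulmxA mulmxV // mul1mx mulmxK.
- have -> : h1 *m a1 *m invmx h1 *m (h1 *m A *m invmx h2) +
      h1 *m A *m invmx h2 *m (h2 *m a2 *m invmx h2)
    = h1 *m (a1 *m A + A *m a2) *m invmx h2.
    by rewrite mulmxDr mulmxDl !mulmxA !mulmxKV.
  split=> [->|/(congr1 (fun B => invmx h1 *m B *m h2))].
    by rewrite mulmx0 mul0mx.
  by rewrite !mulmxA mulVmx // mul1mx mulmxKV // mulmx0 mul0mx.
Qed.

(** Block diagonal factors act on each block of [A] separately, so the equation splits into one
    equation per pair of Jordan blocks. *)
Lemma has_dim_mxdiag_jordan (p q : nat) (p_ : 'I_p -> nat) (q_ : 'I_q -> nat) :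
  has_dim (\sum_i \sum_j minn (p_ i) (q_ j))
    (fun A : 'M[K]_(\sum_i p_ i, \sum_j q_ j) =>
      \mxdiag_i jordan_block K (p_ i) *m A + A *m \mxdiag_j jordan_block K (q_ j)
        = 0).
Proof.
have [e [f [line eK ef]]] := has_dim_mxblock
  (fun i j => has_dim_jordan_block (p_ i) (q_ j)).
exists e, f; split=> // A; rewrite -ef.
rewrite -[A in X in X <-> _]submxblockK mul_mxdiag_mxblock mul_mxblock_mxdiag.
rewrite -mxblockD -mxblock0; split=> [/eq_mxblockP kerA i j|kerA].
  exact: kerA.
by apply/eq_mxblockP => i j; exact: kerA.
Qed.

Lemma has_dim_castmx (m m' n n' d : nat) (em : m = m') (en : n = n')
    (a1 : 'M[K]_m) (a2 : 'M[K]_n) :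
  has_dim d (fun A : 'M[K]_(m, n) => a1 *m A + A *m a2 = 0) ->
  has_dim d (fun A : 'M[K]_(m', n') =>
     castmx (em, em) a1 *m A + A *m castmx (en, en) a2 = 0).
Proof. by case: m' / em; case: n' / en; rewrite !castmx_id. Qed.

End SylvesterKernel.

(** * Rank modulo a prime ideal as rank at points *)

(** Think of [phi x] as evaluation at [x]. A minor is nonzero modulo [q] exactly when it is nonzero
    at some point of [O], so the rank modulo [q] is the maximum of the ranks at points. *)
Lemma rank_mod_constant (R : comNzRingType) (q : prime_idealr R) (F : fieldType)
    (X : Type) (O : X -> Prop) (phi : X -> {rmorphism R -> F}) (x0 : X)
    (a b r : nat) (M : 'M[R]_(a, b)) :
    (forall p, (p \in (q : pred R)) <-> forall x, O x -> phi x p = 0) ->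
    O x0 -> (forall x, O x -> \rank (map_mx (phi x) M) = r) ->
  rank_mod q M = r.
Proof.
move=> qE Ox0 rankE.
have minorE s : (s <= rank_mod q M)%N <->
    exists x, O x /\ (s <= \rank (map_mx (phi x) M))%N.
  rewrite /rank_mod mxrank_minor; split=> [[f [g]]|[x [Ox]]].
    rewrite -map_mxsub det_map_mx residue_eq0 => /negP qdet.
    have /existsNP[x /not_implyP[Ox /eqP detx]] :
        ~ forall x, O x -> phi x (\det (mxsub f g M)) = 0 by move=> /qE.
    exists x; split=> //; apply/mxrank_minor; exists f, g.
    by rewrite -map_mxsub det_map_mx.
  move=> /mxrank_minor[f [g]]; rewrite -map_mxsub det_map_mx => detx.
  exists f, g; rewrite -map_mxsub det_map_mx residue_eq0.
  by apply/negP => /qE/(_ x Ox)/eqP; apply/negP.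
apply/eqP; rewrite eqn_leq; apply/andP; split.
  have /minorE[x [Ox]] := leqnn (rank_mod q M); by rewrite rankE.
by apply/minorE; exists x0; rewrite rankE.
Qed.

(** The trace pairing is nondegenerate: pairing with [delta_mx j i] extracts the entry [A i j]. *)
Lemma mxtrace_mul_eq0 (K : fieldType) (m n : nat) (A : 'M[K]_(m, n)) :
  (forall B : 'M[K]_(n, m), \tr (B *m A) = 0) -> A = 0.
Proof.
move=> trA; apply/matrixP => i j; rewrite mxE -(trA (delta_mx j i)).
rewrite /mxtrace (bigD1 j) //= big1 ?addr0 => [|k kj].
  rewrite mxE (bigD1 i) //= big1 ?addr0 => [|l li].
    by rewrite mxE !eqxx mul1r.
  by rewrite mxE (negPf li) andbF mul0r.
by rewrite mxE big1 // => l _; rewrite mxE (negPf kj) mul0r.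
Qed.

(** * The form on the odd part at a point, and its radical *)

Section GramMatrix.
Variables (K : fieldType) (m n : nat).
Local Notation g0 := ('M[K]_m * 'M[K]_n)%type.
Local Notation g1 := ('M[K]_(m, n) * 'M[K]_(n, m))%type.
Implicit Types (u v w : g1) (x : g0).

Definition odd_form x u v : K := gl_form (gl_br11 u v) x.

(** Cyclicity of the trace brings [v] to the front, so the other factors are the expressions whose
    vanishing defines the radical. *)
Lemma odd_formE x u v :
  odd_form x u v = \tr (v.2 *m (x.1 *m u.1 + u.1 *m x.2))
                 + \tr (v.1 *m (x.2 *m u.2 + u.2 *m x.1)).
Proof.
rewrite /odd_form /gl_form /gl_br11 /odd_mx !mulmx_block.
rewrite !(mulmx0, mul0mx, addr0, add0r) add_block_mx /even_of /=.
rewrite block_mxKul block_mxKdr !mulmxDl !mulmxDr !mxtraceD.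
rewrite -!mulmxA [\tr (u.1 *m _)]mxtrace_mulC [\tr (u.2 *m _)]mxtrace_mulC.
by rewrite -!mulmxA; ring.
Qed.

Lemma gl_form_scalarl x : scalar (@gl_form K m n ^~ x).
Proof.
move=> a y z; rewrite /gl_form /= !mulmxDl -!scalemxAl !mxtraceD !mxtraceZ.
by ring.
Qed.

Lemma odd_form_scalar x u : scalar (odd_form x u).
Proof. by move=> a v w; rewrite /odd_form gl_br11_linear gl_form_scalarl. Qed.

HB.instance Definition _ x u := GRing.isLinear.Build K g1 K *%R (odd_form x u)
  (odd_form_scalar x u).

Lemma odd_form_sym x u v : odd_form x u v = odd_form x v u.
Proof. by rewrite /odd_form gl_br11_sym. Qed.

(** Testing on [(0, B)] and [(B, 0)] separates the two equations; nondegeneracy of the trace pairing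
    yields each. *)
Lemma odd_form_radical x u :
  (forall v, odd_form x u v = 0) <->
  x.1 *m u.1 + u.1 *m x.2 = 0 /\ x.2 *m u.2 + u.2 *m x.1 = 0.
Proof.
split=> [rad|[e1 e2] v]; last by rewrite odd_formE e1 e2 !mulmx0 !mxtrace0 addr0.
by split; apply: mxtrace_mul_eq0 => B;
  [have := rad (0, B) | have := rad (B, 0)];
  rewrite odd_formE /= mul0mx mxtrace0 ?addr0 ?add0r.
Qed.

(** Coordinates in the basis [v] identify the radical with the left kernel of the Gram matrix. *)
Lemma rank_odd_form_mx x (N d1 d2 : nat) (v : N.-tuple g1) :
    basis_of {:g1} v ->
    has_dim d1 (fun A : 'M[K]_(m, n) => x.1 *m A + A *m x.2 = 0) ->
    has_dim d2 (fun A : 'M[K]_(n, m) => x.2 *m A + A *m x.1 = 0) ->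
  (\rank (\matrix_(i, j) odd_form x (tnth v i) (tnth v j)) + (d1 + d2))%N = N.
Proof.
move=> bv dim1 dim2; apply: rank_has_dim_ker.
have coordK (u : g1) : u = \sum_i coord v i u *: v`_i.
  exact: (coord_basis bv (memvf u)).
have := has_dim_pair dim1 dim2.
apply: (has_dim_iso (f := fun u : g1 => \row_i coord v i u)
  (g := fun w : 'rV_N => \sum_i w 0 i *: v`_i)).
- by move=> a u w; apply/rowP => i; rewrite !mxE linearP.
- by move=> u /=; rewrite {2}[u]coordK; apply: eq_bigr => i _; rewrite mxE.
- move=> w; apply/rowP => i; rewrite mxE coord_sum_free //.
  exact: basis_free bv.
- move=> u; rewrite -odd_form_radical.
  have mulE j : (\row_i coord v i u *m
      \matrix_(i, j) odd_form x (tnth v i) (tnth v j)) 0 j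
      = odd_form x u (tnth v j).
    rewrite odd_form_sym [in RHS](coordK u) linear_sum mxE.
    apply: eq_bigr => i _.
    by rewrite linearZ !mxE odd_form_sym -tnth_nth.
  split=> [rad|/rowP ker w]; first by apply/rowP => j; rewrite mulE rad mxE.
  rewrite [w]coordK linear_sum big1 // => j _.
  by rewrite linearZ /= -tnth_nth -mulE ker mxE mulr0.
Qed.

End GramMatrix.

(** * Dual partitions and sums of minima *)

Section Partitions.
Local Open Scope nat_scope.

Lemma sum_leq_indicator (B x : nat) :
  x <= B -> \sum_(1 <= k < B.+1) (k <= x) = x.
Proof.
move=> le_xB; rewrite (big_cat_nat (n := x.+1)) //= [X in _ + X]big1_seq.
  rewrite addn0 (eq_big_nat _ _ (F2 := fun=> 1)) => [|k /andP[_]].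
    by rewrite sum_nat_const_nat muln1 subn1.
  by rewrite ltnS => ->.
by move=> k /andP[_]; rewrite mem_index_iota ltnNge => /andP[/negPf ->].
Qed.

Lemma part_leq (n : nat) (mu : intpart n) (i : nat) : nth 0 mu i <= n.
Proof.
case: (ltnP i (size mu)) => [lt_i|le_i]; last by rewrite nth_default.
by rewrite -[X in _ <= X](parts_sum mu) (bigD1 (Ordinal lt_i)) //= leq_addr.
Qed.

Lemma dual_partE (n : nat) (mu : intpart n) (k : nat) :
  dual_part mu k = \sum_(i < size mu) (k <= nth 0 mu i).
Proof.
by rewrite /dual_part -sum1_count big_mkcond (big_nth 0) big_mkord.
Qed.

(** A minimum is the sum over [k] of the product of the indicators of [k <= mu_i] and [k <= nu_j];
    exchanging sums gives the dual parts. *)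
Lemma sum_minn_dual_part (m n : nat) (mu : intpart m) (nu : intpart n) :
  \sum_(i < size mu) \sum_(j < size nu) minn (nth 0 mu i) (nth 0 nu j) =
  \sum_(1 <= k < (maxn m n).+1) dual_part mu k * dual_part nu k.
Proof.
under [RHS]eq_bigr do rewrite !dual_partE big_distrlr /=.
rewrite [RHS]exchange_big; apply: eq_bigr => i _.
rewrite [RHS]exchange_big; apply: eq_bigr => j _.
rewrite -[LHS](@sum_leq_indicator (maxn m n)); last first.
  by have := part_leq mu i; lia.
by apply: eq_bigr => k _; rewrite leq_min mulnb.
Qed.

End Partitions.

(** * The value of k on a nilpotent orbit *)

Lemma has_dim_jordan_nilp (K : fieldType) (m n : nat) (mu : intpart m)
    (nu : intpart n) :
  has_dim (\sum_(1 <= k < (maxn m n).+1) dual_part mu k * dual_part nu k)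
    (fun A : 'M[K]_(m, n) =>
      jordan_nilp K mu *m A + A *m jordan_nilp K nu = 0).
Proof.
rewrite -sum_minn_dual_part.
exact/has_dim_castmx/has_dim_mxdiag_jordan.
Qed.

Lemma k_number_orbit (K : numFieldType) (m n N r : nat)
    (a : 'M[K]_m * 'M[K]_n) (v : N.-tuple (odd_part (gl K m n))) :
    (forall x, gl_orbit a x ->
      \rank (\matrix_(i, j) odd_form x (tnth v i) (tnth v j)) = r) ->
  k_number v (orbit_prime a) = r.
Proof.
move=> rankE; pose g0 : vectType K := ('M[K]_m * 'M[K]_n)%type.
pose phi (x : g0) : {rmorphism symalg g0 -> K} :=
  meval (fun i : 'I_(\dim {:g0}) => gl_form (vbasis {:g0})`_i x).
apply: (@rank_mod_constant _ _ _ _ (gl_orbit a) phi a).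
- by move=> p; split=> [/asboolP|h]; last apply/asboolP.
- exists (1%:M, 1%:M); rewrite /= !unitmx1 !invmx1 !mul1mx !mulmx1.
  by split=> //; case: (a).
- move=> x Ox; rewrite -(rankE x Ox); congr (\rank _).
  apply/matrixP => i j; rewrite !mxE.
  (* Evaluating a bracket at [x] pairs it with [x], so the evaluated matrix is the Gram matrix of
     [odd_form x]. *)
  apply: sym_fun_incl; exact: gl_form_scalarl.
Qed.

Theorem theorem3p2 (R : realType) (m n : nat) (mu : intpart m) (nu : intpart n)
    (N : nat) (v : N.-tuple (odd_part (gl R[i] m n))) :
  basis_of {: odd_part (gl R[i] m n)} v ->
  (@k_number R[i] (gl R[i] m n) N v
     (orbit_prime (jordan_nilp R[i] mu, jordan_nilp R[i] nu)))%:Z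
  = 2 * ((m * n)%N%:Z
         - \sum_(1 <= i < (maxn m n).+1) (dual_part mu i * dual_part nu i)%N%:Z).
Proof.
move=> bv; pose s := (\sum_(1 <= k < (maxn m n).+1) dual_part mu k * dual_part nu k)%N.
have NE : N = (m * n + n * m)%N.
  rewrite -(vector.size_basis bv) dimvf.
  exact: congr2 (dim_matrix R[i] m n) (dim_matrix R[i] n m).
have rankE x : gl_orbit (jordan_nilp R[i] mu, jordan_nilp R[i] nu) x ->
    (\rank (\matrix_(i, j) odd_form x (tnth v i) (tnth v j)) + (s + s))%N = N.
  case=> -[h1 h2] /= [u1 u2 ->]; apply: rank_odd_form_mx => //=.
    exact/has_dim_conj/has_dim_jordan_nilp.
  (* The second kernel is the first with the two factors exchanged, and [s] is symmetric in them. *)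
  apply: has_dim_conj => //; rewrite /s maxnC.
  under eq_bigr do rewrite mulnC.
  exact: has_dim_jordan_nilp.
rewrite (@k_number_orbit _ _ _ _ (N - (s + s))) => [|x /rankE rk]; last first.
  by rewrite -[X in (X - _)%N]rk addnK.
(* A point of the orbit shows [s + s <= N], so the truncated subtraction [N - (s + s)] is exact. *)
have [x Ox] : exists x, gl_orbit (jordan_nilp R[i] mu, jordan_nilp R[i] nu) x.
    exists (jordan_nilp R[i] mu, jordan_nilp R[i] nu), (1%:M, 1%:M).
    by rewrite /= !unitmx1 !invmx1 !mul1mx !mulmx1.
by have := rankE x Ox; rewrite -(big_morph Posz PoszD (erefl _)) -/s; lia.
Qed.
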